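(* Let $n\ge1$ be an odd integer and let $(St_M^{(n)})_{M=1}^\infty$ be the sequence of $M\times n$ stairs. Then the limit per-tile entropy of tilings by $n$-ribbons for this family of regions is $$\lim_{M\to\infty}\frac{\log_2|\mathcal{T}_n(St_M^{(n)})|}{M}=\log_2(n+1)-1 .$$
   Context: An $n$-ribbon is a connected sequence of $n$ unit squares of the square lattice, each of which (except the first) lies directly above or directly to the right of its predecessor. A tiling of a region by $n$-ribbons is a set of $n$-ribbons with pairwise disjoint interiors whose union is the region; $\mathcal{T}_n(R)$ is the set of all tilings of $R$ by $n$-ribbons. The stair $St_M^{(n)}$ is the region with $M$ rows, each consisting of $n$ consecutive unit squares, each row being offset by one square to the right relative to the row directly below it; explicitly, it is $\bigcup_{j=0}^{M-1}[j,j+n]\times[j,j+1]$. Each tiling of $St_M^{(n)}$ has $M$ tiles. *)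

(* Defs.v *)
From mathcomp Require Import all_boot all_order all_algebra.
From mathcomp Require Import finmap.
From mathcomp Require Import all_classical all_reals all_analysis.
Import Order.TTheory GRing.Theory Num.Theory.
Import numFieldNormedType.Exports.

Set Implicit Arguments.
Unset Strict Implicit.
Unset Printing Implicit Defensive.

Local Open Scope ring_scope.
Local Open Scope fset_scope.

(* The unit square [x, x+1] x [y, y+1] is represented by its lower left corner
   (x, y), and a region by its finite set of unit squares. Two regions have
   disjoint interiors exactly when they have no unit square in common. *)
Notation square := (int * int)%type.

Definition above_or_right (a b : square) : bool :=
  (b == (a.1, a.2 + 1)%R) || (b == (a.1 + 1, a.2)%R).

(* The sequence underlying a ribbon is determined by its set of squares, since
   x + y increases by 1 at every step; a tile is hence identified with that
   set. *)
Definition ribbon (n : nat) (A : {fset square}) : Prop :=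
  exists s : seq square,
    [/\ size s = n, sorted above_or_right s & A = [fset x in s]].

Definition tiling (n : nat) (D : {fset square}) (T : {fset {fset square}}) :
    Prop :=
  [/\ forall A, A \in T -> ribbon n A,
      forall A B, A \in T -> B \in T -> A != B -> [disjoint A & B] &
      \bigcup_(A <- T) A = D].

(* The bound by the iterated powerset only makes the collection finite, and
   discards no tiling, by [in_tilings]. *)
Definition tilings (n : nat) (D : {fset square}) :
    {fset {fset {fset square}}} :=
  [fset T in fpowerset (fpowerset D) | `[< tiling n D T >]].

Lemma in_tilings (n : nat) (D : {fset square}) (T : {fset {fset square}}) :
  T \in tilings n D <-> tiling n D T.
Proof.
rewrite /tilings !inE /=; split=> [/andP[_ /asboolP //]|hT].
apply/andP; split; last exact/asboolP.
rewrite fpowersetE; apply/fsubsetP => A AT.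
rewrite fpowersetE; case: hT => _ _ <-.
exact: bigfcup_sup.
Qed.

Definition stair (n M : nat) : {fset square} :=
  [fset ((j + i)%N%:Z, j%:Z) | j in iota 0 M, i in iota 0 n].

Definition log2 {R : realType} (x : R) : R := ln x / ln 2.

(* Main.v *)
(* Call [x + y] the level of a square: a ribbon of length [n] has one square in
   each of [n] consecutive levels. Comparing generating functions of levels shows
   that a tiling of the stair has exactly one tile starting at each of the levels
   [0, 2, ..., 2(M-1)], as the tiling by rows does. A tiling is thus a system of
   vertex-disjoint lattice routes filling every level, and it is determined by
   the rows in which its tiles start. For [n = 2k+1] routes start on passing to an
   even level and end on passing to an odd one, and every choice of starting rows
   extends to a tiling; there are at most [k+1] choices per tile, and exactly
   [k+1] from tile [k] on. Hence the number of tilings lies between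
   [(k+1)^(M-k)] and [(k+1)^M]. *)
Require Import Defs.
From mathcomp Require Import all_boot all_order all_algebra.
From mathcomp Require Import zify.
From mathcomp Require Import finmap.
From mathcomp Require Import all_classical all_reals all_analysis.
Import Order.TTheory GRing.Theory Num.Theory.
Import numFieldNormedType.Exports.
Set Implicit Arguments.
Unset Strict Implicit.
Unset Printing Implicit Defensive.

(** * Route systems and their dependence on the starting rows *)

(* Tile [i] starts at level [2i], and so does row [i] of the stair: hence [alive]
   describes both the tiles and the rows that meet level [L]. *)
Definition alive (n M i L : nat) : bool :=
  [&& i < M, i.*2 <= L & L < i.*2 + n].

(** [p i L] stands for the row of tile [i] at level [L]; [route_alive] keeps that square in the
    stair. *)
Record route_system (n M : nat) (p : nat -> nat -> nat) : Prop := RouteSystem {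
  route_step : forall i L, alive n M i L -> alive n M i L.+1 ->
    p i L.+1 = p i L \/ p i L.+1 = (p i L).+1;
  route_inj : forall i j L, alive n M i L -> alive n M j L ->
    p i L = p j L -> i = j;
  route_alive : forall i L, alive n M i L -> alive n M (p i L) L }.

(** At each level, tiles and rows are indexed by the same finite set, and an injective self-map of
    it is onto. *)
Lemma route_surj (n M : nat) (p : nat -> nat -> nat) (L r : nat) :
  route_system n M p -> alive n M r L -> exists2 i, alive n M i L & p i L = r.
Proof.
move=> [_ pI pA] rA; pose s := [seq i <- iota 0 M | alive n M i L].
have sE i : (i \in s) = alive n M i L.
  by rewrite mem_filter mem_iota /=; apply/andb_idr => /and3P[].
have us : uniq (map (p^~ L) s).
  by rewrite map_inj_in_uniq ?filter_uniq ?iota_uniq// => i j; rewrite !sE; apply: pI.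
have ss : {subset map (p^~ L) s <= s}.
  by move=> x /mapP[i]; rewrite !sE => iA ->; apply: pA.
have [_ /(_ r)] := uniq_min_size us ss (eq_leq (esym (size_map _ _))).
by rewrite sE rA => /mapP[i]; rewrite sE; exists i.
Qed.

(** Every row of the next level must be filled. Going up from the lowest row, this decides for each
    continuing tile whether it stays or moves up, once the starting rows are known. *)
Lemma route_unique (n M : nat) (p q : nat -> nat -> nat) :
  route_system n M p -> route_system n M q ->
  (forall i, i < M -> p i i.*2 = q i i.*2) ->
  forall L i, alive n M i L -> p i L = q i L.
Proof.
move=> pS qS; have [[pT pI pA] [qT qI qA]] := (pS, qS).
move=> pq0; elim=> [|L IH] i iA.
  have i0 : i = 0 by move: iA; rewrite /alive; lia.
  by rewrite i0 (pq0 0) //; move: iA; rewrite /alive; lia.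
have [iL|iL] := eqVneq i.*2 L.+1.
  by rewrite -iL pq0 //; case/and3P: iA.
have old j : alive n M j L.+1 -> j.*2 != L.+1 -> alive n M j L.
  by rewrite /alive; lia.
(* By symmetry it suffices to rule out that [p] stays in row [p i L] while [q]
   moves up; the route which then takes row [p i L] in [q] comes from the row
   below. *)
have key (p' q' : nat -> nat -> nat) : route_system n M p' -> route_system n M q' ->
    (forall i, i < M -> p' i i.*2 = q' i i.*2) ->
    (forall j, alive n M j L -> p' j L = q' j L) ->
    forall r j, alive n M j L.+1 -> j.*2 != L.+1 -> p' j L = r ->
    (forall l, alive n M l L.+1 -> l.*2 != L.+1 -> p' l L < r ->
       p' l L.+1 = q' l L.+1) ->
    p' j L.+1 = r -> q' j L.+1 = r.+1 -> False.
  move=> pS' qS' pq0' pqL r j jA jL jr lt_r pj qj.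
  have rA : alive n M r L.+1 by rewrite -pj; apply: (route_alive pS').
  have [l lA ql] := route_surj qS' rA.
  have lj : l <> j by move=> lj; move: qj; rewrite -lj ql; lia.
  have lL : l.*2 != L.+1.
    apply/eqP => lL; apply: lj; apply: (route_inj pS' lA jA).
    by rewrite pj -lL pq0' ?lL //; case/and3P: lA.
  have lA' := old _ lA lL.
  have plL : p' l L != r.
    apply/eqP => pl; apply: lj; apply: (route_inj pS' lA' (old _ jA jL)).
    by rewrite pl jr.
  have := route_step qS' lA' lA; rewrite ql -(pqL _ lA') => st.
  have pl : p' l L < r by case: st => st; lia.
  by apply: lj; apply: (route_inj pS' lA jA); rewrite lt_r // ql pj.
move: {2}(p i L) (erefl (p i L)) => r.
elim/ltn_ind: r i iA iL => r IHr i iA iL ir.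
have lt_r l : alive n M l L.+1 -> l.*2 != L.+1 -> p l L < r -> p l L.+1 = q l L.+1.
  by move=> lA lL lr; apply: (IHr (p l L)).
have iA' := old _ iA iL.
have := pT _ _ iA' iA; have := qT _ _ iA' iA; rewrite -IH // ir.
case=> qi [] pi; rewrite ?qi ?pi //; exfalso.
  apply: (key q p qS pS _ _ r i) => //.
  - by move=> l lM; rewrite pq0.
  - by move=> l lA; rewrite IH.
  - by rewrite -IH.
  - by move=> l lA lL; rewrite -(IH _ (old _ lA lL)) => lr; rewrite lt_r.
exact: (key p q pS qS _ _ r i).
Qed.

(** * Construction of a route system from its starting rows *)

Section Routes.
Variables (k M : nat) (b : nat -> nat).
(** For [n = 2k+1] the rows meeting level [2j] are among [j - k, ..., j]. An index [j >= M] starts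
    no tile; its fictitious row [b j = j] lies above the stair, so that no route is pushed. *)
Hypothesis b_bound : forall j, b j <= j <= b j + k.
Hypothesis b_late : forall j, M <= j -> b j = j.

(* Passing to an even level [2j], a route starts in row [b j] and pushes up all
   routes at or above this row; passing to an odd level [2j+1], the route [j - k]
   ends and the routes below it move up. *)
Fixpoint route (L i : nat) : nat :=
  if L is L'.+1 then
    let r := route L' i in
    if i.*2 == L then b i
    else if odd L' then r + (b L./2 <= r)
    else if k <= L'./2 then r + (r < route L' (L'./2 - k))
    else r
  else b i.

Lemma route_start i : route i.*2 i = b i.
Proof. by case: i => [|i] //=; rewrite eqxx. Qed.

Let A := alive k.*2.+1 M.

(** Pushing up from [b j] vacates that row. Moving up the routes below the ended one fills its gap
    and vacates the lowest row, which ends at the same time; this uses that the routes are distinct,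
    whence a joint induction. *)
Lemma route_invariant L :
  (forall i, A i L -> A (route L i) L) /\
  (forall i j, A i L -> A j L -> route L i = route L j -> i = j).
Proof.
elim: L => [|L [IHa IHi]].
  split=> [i|i j]; rewrite /A /alive /=; last by lia.
  by have := b_bound i; lia.
have old j : A j L.+1 -> j.*2 != L.+1 -> A j L by rewrite /A /alive; lia.
have [oddL|evenL] := boolP (odd L).
  have LE := odd_double_half L; rewrite oddL in LE.
  have Lj : uphalf L = (L./2).+1 by lia.
  have := b_bound (L./2).+1; have := @b_late (L./2).+1.
  split=> [i iA|i j iA jA] /=; rewrite oddL Lj.
    case: eqVneq => [iL|/(old _ iA) /IHa]; last by rewrite /A /alive; lia.
    by have := b_bound i; move: iA; rewrite /A /alive; lia.
  case: eqVneq => iL; case: eqVneq => jL.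
  - lia.
  - have -> : i = (L./2).+1 by lia.
    lia.
  - have -> : j = (L./2).+1 by lia.
    lia.
  - by move=> ?; apply: IHi; [exact: old|exact: old|lia].
have LE := odd_double_half L; rewrite (negbTE evenL) /= add0n in LE.
have noL j : (j.*2 == L.+1) = false by apply/eqP; lia.
split=> [i iA|i j iA jA] /=; rewrite (negbTE evenL) !noL.
  have iA' := old _ iA (negbT (noL i)).
  have := IHa _ iA'; case: (leqP k L./2) => kL; last by rewrite /A /alive; lia.
  (* Alive indices are at least [L./2 - k], so the ending tile exists as soon as some tile is
     alive. *)
  have [kM|kM] := ltnP (L./2 - k) M; last by move: iA'; rewrite /A /alive; lia.
  have dA : A (L./2 - k) L by rewrite /A /alive; lia.
  have := IHi _ _ iA' dA; have := IHa _ dA; move: iA.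
  by rewrite /A /alive; lia.
have [iA' jA'] := (old _ iA (negbT (noL i)), old _ jA (negbT (noL j))).
have ij := IHi _ _ iA' jA'; case: (leqP k L./2) => // kL.
have [kM|kM] := ltnP (L./2 - k) M; last by move: iA'; rewrite /A /alive; lia.
have dA : A (L./2 - k) L by rewrite /A /alive; lia.
have := IHi _ _ iA' dA; have := IHi _ _ jA' dA; move: iA jA.
by rewrite /A /alive; lia.
Qed.

Lemma route_systemP : route_system k.*2.+1 M (fun i L => route L i).
Proof.
split=> [i L iA iA1|i j L|i L]; last first.
- exact: (route_invariant L).1.
- exact: (route_invariant L).2.
have -> /= : route L.+1 i = if odd L then route L i + (b (L.+1)./2 <= route L i)
    else if k <= L./2 then route L i + (route L i < route L (L./2 - k))
    else route L i.
  by rewrite /=; have -> : i.*2 == L.+1 = false by move: iA; rewrite /alive; lia.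
by case: ifP => _; [|case: ifP => _; [|by left]];
  case: (X in _ + nat_of_bool X); rewrite ?addn0 ?addn1; auto.
Qed.

End Routes.

(** * Ribbons in the stair as graphs over levels *)

Local Open Scope ring_scope.
Local Open Scope fset_scope.
Local Open Scope classical_set_scope.

Lemma uniq_map_inj (T U : eqType) (f : T -> U) (s : seq T) :
  uniq [seq f x | x <- s] -> {in s &, injective f}.
Proof.
move=> us x y xs ys fxy.
rewrite -(nth_index x xs) -(nth_index x ys); congr (nth x s _).
apply: (uniqP (f x) us); rewrite ?inE ?size_map ?index_mem //.
by rewrite !(nth_map x) ?index_mem // !nth_index.
Qed.

(** Stair squares have nonnegative coordinates, so there the absolute value is harmless. *)
Definition level (q : square) : nat := `|(q.1 + q.2)%R|%N.

Definition level_square (L r : nat) : square := (L%:Z - r%:Z, r%:Z).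

Lemma level_square_inj (L L' r r' : nat) :
  level_square L r = level_square L' r' -> L = L' /\ r = r'.
Proof. by case=> h1 h2; split; lia. Qed.

Lemma level_square_stair (n M L r : nat) :
  (level_square L r \in stair n M) = alive n M r L.
Proof.
apply/imfset2P/idP => [[j /= jM [i /= iM /pair_equal_spec [h1 h2]]]|rA].
  by move: jM iM; rewrite !mem_iota /alive; lia.
exists r => /=; first by move: rA; rewrite mem_iota /alive; lia.
exists (L - r.*2)%N => /=; first by move: rA; rewrite mem_iota /alive; lia.
by rewrite /level_square; congr pair; move: rA; rewrite /alive; lia.
Qed.

Lemma stair_level_square (n M : nat) (q : square) :
  q \in stair n M -> q = level_square (level q) `|q.2|%N.
Proof.
case/imfset2P=> j /= jM [i /= iM ->]; rewrite /level_square /level /=.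
by congr pair; lia.
Qed.

(** Level and row serve as coordinates: a ribbon is the graph over its levels of a function that
    grows by 0 or 1 at each step. *)
Definition route_fset (n l : nat) (f : nat -> nat) : {fset square} :=
  [fset level_square L (f L) | L in iota l n].

Lemma in_route_fset (n l : nat) (f : nat -> nat) (L r : nat) :
  (level_square L r \in route_fset n l f) = (l <= L < l + n)%N && (r == f L).
Proof.
apply/imfsetP/idP => [[K /= Kl /level_square_inj[-> ->]]|/andP[Ll /eqP ->]].
  by rewrite eqxx andbT -mem_iota.
by exists L => //=; rewrite mem_iota.
Qed.

Lemma route_fsetP (n l : nat) (f : nat -> nat) (q : square) :
  q \in route_fset n l f ->
  exists2 L, (l <= L < l + n)%N & q = level_square L (f L).
Proof. by case/imfsetP=> L /=; rewrite mem_iota => Ll ->; exists L. Qed.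

Lemma ribbon_route_fset (n l : nat) (f : nat -> nat) :
  (forall L, (l <= L)%N -> (L.+1 < l + n)%N ->
     f L.+1 = f L \/ f L.+1 = (f L).+1) ->
  ribbon n (route_fset n l f).
Proof.
move=> fS; exists [seq level_square L (f L) | L <- iota l n]; split.
- by rewrite size_map size_iota.
- apply/(sortedP (0, 0)) => i; rewrite size_map size_iota => iN.
  rewrite !(nth_map 0%N) ?size_iota ?nth_iota //; try lia.
  rewrite addnS; have := fS (l + i)%N (leq_addr _ _).
  case=> [|->|->]; first lia.
    apply/orP; right; apply/eqP; rewrite /level_square /=; congr pair; lia.
  apply/orP; left; apply/eqP; rewrite /level_square /=; congr pair; lia.
apply/fsetP => q; rewrite in_fset /=; apply/imfsetP/mapP => -[L /= Ll ->];
  by exists L.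
Qed.

Lemma ribbon_in_stair (n M : nat) (A : {fset square}) :
  ribbon n A -> (A `<=` stair n M)%fset ->
  exists (l : nat) (f : nat -> nat),
    (forall L, (l <= L)%N -> (L.+1 < l + n)%N ->
       f L.+1 = f L \/ f L.+1 = (f L).+1) /\ A = route_fset n l f.
Proof.
move=> [s [sn ss ->]] /fsubsetP sub.
pose q i := nth (0, 0) s i.
have qE i : (i < n)%N -> q i = level_square (level (q i)) `|(q i).2|%N.
  move=> iN; apply: (@stair_level_square n M); apply: sub.
  by rewrite in_fset; apply: mem_nth; rewrite sn.
have qS i : (i.+1 < n)%N -> level (q i.+1) = (level (q i)).+1 /\
    (`|(q i.+1).2|%N = `|(q i).2|%N \/ `|(q i.+1).2|%N = `|(q i).2|.+1%N).
  move=> iN; have /(sortedP (0, 0)) /(_ i) := ss; rewrite sn => /(_ iN).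
  rewrite -/(q i) -/(q i.+1) (qE i (ltnW iN)) (qE _ iN).
  by rewrite /above_or_right /level /level_square /=; case/orP => /eqP [h1 h2]; lia.
set l := level (q 0%N).
have ql i : (i < n)%N -> level (q i) = (l + i)%N.
  by elim: i => [|i IH] iN; [rewrite addn0|rewrite (qS i iN).1 IH ?addnS // ltnW].
(* The square at level [L] has index [L - l] in the sequence; values outside the levels of the
   ribbon are arbitrary. *)
exists l, (fun L => `|(q (L - l)%N).2|%N); split.
  move=> L lL Ln; rewrite subSn //; apply: (qS _ _).2; lia.
apply/fsetP => x; rewrite in_fset /=; apply/(nthP (0, 0))/imfsetP => /=.
  case=> i; rewrite sn => iN <-; exists (l + i)%N.
    by rewrite mem_iota; lia.
  by rewrite addKn -ql // -qE.
case=> L; rewrite mem_iota => LL ->; exists (L - l)%N; first by lia.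
by rewrite -/(q _) {1}qE ?ql; [congr level_square; lia|lia|lia].
Qed.

(** * Tilings from route systems *)

Definition route_tiling (n M : nat) (p : nat -> nat -> nat) :
    {fset {fset square}} :=
  [fset route_fset n i.*2 (p i) | i in iota 0 M].

Lemma route_tilingP (n M : nat) (p : nat -> nat -> nat) (A : {fset square}) :
  reflect (exists2 i, (i < M)%N & A = route_fset n i.*2 (p i))
    (A \in route_tiling n M p).
Proof.
by apply: (iffP (imfsetP _ _ _ _)) => -[i /= iM ->]; exists i => //;
  move: iM; rewrite /= mem_iota.
Qed.

(** Disjointness comes from [route_inj], covering from [route_surj]. *)
Lemma tiling_route_tiling (n M : nat) (p : nat -> nat -> nat) :
  route_system n M p -> tiling n (stair n M) (route_tiling n M p).
Proof.
move=> pS; split.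
- move=> A /route_tilingP[i iM ->]; apply: ribbon_route_fset => L lL Ln.
  by apply: (route_step pS); rewrite /alive iM /=; lia.
- move=> A B /route_tilingP[i iM ->] /route_tilingP[j jM ->] AB.
  apply/fdisjointP => q /route_fsetP[L Li ->].
  rewrite in_route_fset; apply: contraNN AB => /andP[Lj /eqP pij].
  by rewrite (route_inj pS _ _ pij) // /alive ?iM ?jM.
apply/fsetP => q; apply/bigfcupP/idP.
  case=> A; rewrite andbT => /route_tilingP[i iM ->] /route_fsetP[L Li ->].
  by rewrite level_square_stair; apply: (route_alive pS); rewrite /alive iM.
move=> qD; move: (qD); rewrite (stair_level_square qD) level_square_stair.
move=> /(route_surj pS)[i /and3P[iM iL Li] pi].
exists (route_fset n i.*2 (p i)).
  by rewrite andbT; apply/route_tilingP; exists i.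
by rewrite in_route_fset pi eqxx iL Li.
Qed.

Lemma route_tiling_start (n M : nat) (p q : nat -> nat -> nat) (i : nat) :
  (0 < n)%N -> route_tiling n M p = route_tiling n M q -> (i < M)%N ->
  p i i.*2 = q i i.*2.
Proof.
move=> n0 pq iM.
have /route_tilingP[j jM ij] : route_fset n i.*2 (p i) \in route_tiling n M q.
  by rewrite -pq; apply/route_tilingP; exists i.
have := in_route_fset n i.*2 (p i) i.*2 (p i i.*2).
have := in_route_fset n j.*2 (q j) j.*2 (q j j.*2).
rewrite -{1}ij in_route_fset ij in_route_fset !eqxx !andbT.
have -> : (i.*2 <= i.*2 < i.*2 + n)%N by lia.
have -> : (j.*2 <= j.*2 < j.*2 + n)%N by lia.
move=> /andP[ij1 _] /andP[ij2 /eqP ->].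
by have -> : i = j by lia.
Qed.

Lemma route_tiling_eq (n M : nat) (p q : nat -> nat -> nat) :
  route_system n M p -> route_system n M q ->
  (forall i, (i < M)%N -> p i i.*2 = q i i.*2) ->
  route_tiling n M p = route_tiling n M q.
Proof.
move=> pS qS pq; apply: eq_in_imfset => //= i; rewrite mem_iota /= => iM.
apply: eq_in_imfset => //= L; rewrite mem_iota => Li.
by rewrite (route_unique pS qS pq) // /alive iM.
Qed.

(** * Starting levels of tiles by generating functions *)

(** The coefficient of degree [i] counts the occurrences of [i]. *)
Lemma perm_eq_polyXn (s t : seq nat) :
  \sum_(x <- s) 'X^x = \sum_(x <- t) 'X^x :> {poly int} -> perm_eq s t.
Proof.
have coefE u i : (\sum_(x <- u) 'X^x : {poly int})`_i = (count_mem i u)%:R.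
  rewrite coef_sum -sum1_count natr_sum [RHS]big_mkcond /=.
  by apply: eq_bigr => x _; rewrite coefXn eq_sym; case: eqP.
move=> st; apply/allP => i _ /=; apply/eqP.
have := congr1 (fun P : {poly int} => P`_i) st.
by rewrite !coefE => /eqP; rewrite eqr_nat => /eqP.
Qed.

Definition level_poly (A : {fset square}) : {poly int} :=
  \sum_(q <- A) 'X^(level q).

Lemma level_poly_route_fset (n l : nat) (f : nat -> nat) :
  level_poly (route_fset n l f) = 'X^l * \sum_(0 <= i < n) 'X^i.
Proof.
rewrite /level_poly big_imfset /=; last by move=> L K _ _ /level_square_inj[].
rewrite undup_id ?iota_uniq // -[X in iota X _]addn0 iotaDl big_map mulr_sumr.
rewrite /index_iota subn0.
apply: eq_bigr => i _; rewrite -exprD; congr ('X^_).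
by rewrite /level /level_square /=; lia.
Qed.

Lemma level_poly_tiling (n : nat) (D : {fset square}) (T : {fset {fset square}}) :
  tiling n D T -> level_poly D = \sum_(A <- T) level_poly A.
Proof.
move=> [_ dT <-]; rewrite /level_poly.
by rewrite partition_disjoint_bigfcup.
Qed.

Lemma route_fset_start_inj (n M : nat) (p : nat -> nat -> nat) :
  (0 < n)%N ->
  {in iota 0 M &, injective (fun i => route_fset n i.*2 (p i))}.
Proof.
move=> n0 i j _ _ ij.
have := in_route_fset n i.*2 (p i) i.*2 (p i i.*2).
have := in_route_fset n j.*2 (p j) j.*2 (p j j.*2).
rewrite -{1}ij in_route_fset ij in_route_fset !eqxx !andbT; lia.
Qed.

(** Each tile contributes a monomial for its start times the same factor [1 + X + ... + X^(n-1)].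
    The tiling by rows yields the same polynomial of the stair, and the nonzero factor cancels. *)
Lemma tiling_starts (n M : nat) (T : {fset {fset square}})
    (l : {fset square} -> nat) (f : {fset square} -> nat -> nat) :
  (0 < n)%N -> tiling n (stair n M) T ->
  (forall A, A \in T -> A = route_fset n (l A) (f A)) ->
  perm_eq [seq l A | A <- T] [seq i.*2 | i <- iota 0 M].
Proof.
move=> n0 TT lf; apply: perm_eq_polyXn; rewrite !big_map.
(* The tiling by rows: tile [i] stays in row [i]. *)
have p0S : route_system n M (fun i _ => i) by split=> // i L iA _; left.
pose G : {poly int} := \sum_(0 <= i < n) 'X^i.
have G0 : G != 0.
  have /(contra_neq _) : G`_0 != 0; last by apply=> ->; rewrite coef0.
  rewrite /G -(prednK n0) coef_sum big_nat_recl //= coefXn big1 ?addr0 // => i _.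
  by rewrite coefXn.
apply: (mulIf G0); rewrite !mulr_suml.
transitivity (level_poly (stair n M)).
  rewrite (level_poly_tiling TT) big_seq [RHS]big_seq; apply: eq_bigr => A AT.
  by rewrite {2}(lf _ AT) level_poly_route_fset.
rewrite (level_poly_tiling (tiling_route_tiling p0S)) big_imfset /=; last first.
  exact: (route_fset_start_inj (p := fun i _ => i)).
rewrite undup_id ?iota_uniq //; apply: eq_bigr => i _.
exact: level_poly_route_fset.
Qed.

(** * Route systems from tilings *)

(** The starting levels are [0, 2, ..., 2(M-1)] without repetition, so tile [i] can be taken to be
    the one starting at level [2i]. *)
Lemma tiling_route_system (n M : nat) (T : {fset {fset square}}) :
  (0 < n)%N -> tiling n (stair n M) T ->
  exists2 p, route_system n M p & T = route_tiling n M p.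
Proof.
move=> n0 TT; have [Tr Td TD] := TT.
have Tsub A : A \in T -> (A `<=` stair n M)%fset.
  by move=> AT; rewrite -TD; apply: bigfcup_sup.
have /choice[lf lfP] (A : {fset square}) : exists lf : nat * (nat -> nat), A \in T ->
    (forall L, (lf.1 <= L)%N -> (L.+1 < lf.1 + n)%N ->
       lf.2 L.+1 = lf.2 L \/ lf.2 L.+1 = (lf.2 L).+1) /\
    A = route_fset n lf.1 lf.2.
  have [AT|] := boolP (A \in T); last by exists (0%N, id).
  by have [l [f lf]] := ribbon_in_stair (Tr _ AT) (Tsub _ AT); exists (l, f).
have starts := tiling_starts n0 TT (fun A AT => (lfP A AT).2).
have l_inj : {in T &, injective (fun A => (lf A).1)}.
  suff : uniq [seq (lf A).1 | A <- T].
    by apply: uniq_map_inj.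
  by rewrite (perm_uniq starts) map_inj_uniq ?iota_uniq //; apply: double_inj.
have /choice[t tP] (i : nat) : exists A, (i < M)%N -> A \in T /\ (lf A).1 = i.*2.
  have [iM|] := ltnP i M; last by exists fset0.
  have : i.*2 \in [seq (lf A).1 | A <- T].
    by rewrite (perm_mem starts) map_f // mem_iota.
  by case/mapP => A AT ->; exists A.
have tE i : (i < M)%N -> t i = route_fset n i.*2 (lf (t i)).2.
  by move=> iM; have [iT il] := tP i iM; rewrite -il; apply: (lfP _ iT).2.
have in_t i L : alive n M i L -> level_square L ((lf (t i)).2 L) \in t i.
  move=> /and3P[iM iL Li].
  by rewrite [X in _ \in X](tE i iM) in_route_fset eqxx iL Li.
exists (fun i => (lf (t i)).2).
  split=> [i L iA iA1|i j L iA jA pij|i L iA].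
  - have /tP[iT il] : (i < M)%N by case/and3P: iA.
    by apply: (lfP _ iT).1; rewrite il; move: iA iA1; rewrite /alive; lia.
  - have /tP[iT il] : (i < M)%N by case/and3P: iA.
    have /tP[jT jl] : (j < M)%N by case/and3P: jA.
    apply: double_inj; rewrite -il -jl; congr (lf _).1.
    apply/eqP; apply: contraT => /(Td _ _ iT jT).
    by move=> /fdisjointP /(_ _ (in_t _ _ iA)); rewrite pij in_t.
  - have /tP[iT _] : (i < M)%N by case/and3P: iA.
    by rewrite -level_square_stair; apply: (fsubsetP (Tsub _ iT)); apply: in_t.
apply/fsetP => A; apply/idP/route_tilingP => [AT|[i iM ->]]; last first.
  by rewrite -tE //; apply: (tP i iM).1.
have : (lf A).1 \in [seq (lf A).1 | A <- T] by apply: map_f.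
rewrite (perm_mem starts) => /mapP[i]; rewrite mem_iota => iM lA.
exists i => //; rewrite -tE //.
by apply: l_inj => //; [apply: (tP i iM).1|rewrite lA (tP i iM).2].
Qed.

(** * Bounds on the number of tilings *)

Lemma card_tilings_le (k M : nat) :
  (#|` tilings k.*2.+1 (stair k.*2.+1 M)| <= k.+1 ^ M)%N.
Proof.
set n := k.*2.+1; set Ts := tilings n _.
have /choice[p pP] (T : {fset {fset square}}) : exists p, T \in Ts ->
    route_system n M p /\ T = route_tiling n M p.
  have [/in_tilings TT|] := boolP (T \in Ts); last by exists (fun i _ => i).
  by have [p pS ->] := tiling_route_system (ltn0Sn _) TT; exists p.
(* Tile [i] starts at most [k] rows below row [i]; this drop is its code. *)
pose code T := [ffun i : 'I_M => inord (i - p T i i.*2) : 'I_k.+1].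
have codeE T (i : 'I_M) : T \in Ts -> (p T i i.*2 + code T i = i)%N.
  move=> /pP[pS _]; have : alive n M (p T i i.*2) i.*2.
    by apply: (route_alive pS); rewrite /alive ltn_ord; lia.
  by rewrite /alive /n ffunE => a; rewrite inordK; lia.
have code_inj : {in Ts &, injective code}.
  move=> T U TTs UTs TU; have [[pS ->] [qS ->]] := (pP _ TTs, pP _ UTs).
  apply: (route_tiling_eq pS qS) => i iM.
  have := codeE T (Ordinal iM) TTs; have := codeE U (Ordinal iM) UTs.
  by rewrite TU /=; lia.
have us : uniq [seq code T | T <- Ts] by rewrite map_inj_in_uniq ?fset_uniq.
have := max_card (mem [seq code T | T <- Ts]).
by rewrite (card_uniqP us) size_map card_ffun !card_ord.
Qed.

Lemma card_tilings_ge (k M : nat) :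
  (k.+1 ^ (M - k) <= #|` tilings k.*2.+1 (stair k.*2.+1 M)|)%N.
Proof.
set n := k.*2.+1; set Ts := tilings n _.
(* Tiles from [k] on get a free drop, since all [k+1] drops then give natural rows. For [j >= M] any
   [insub] fails, and the default drop 0 gives [b j = j]. *)
pose b (c : {ffun 'I_(M - k) -> 'I_k.+1}) (j : nat) : nat :=
  if (k <= j)%N then (j - oapp (fun i => val (c i)) 0 (insub (j - k)))%N else j.
pose g c := route_tiling n M (fun i L => route k (b c) L i).
have bS c : route_system n M (fun i L => route k (b c) L i).
  apply: route_systemP => j; rewrite /b; case: ifP => //; try lia.
    by case: insubP => [i _ _|_] /=; [have := ltn_ord (c i)|]; lia.
  by move=> kj Mj; rewrite insubF ?subn0 //; lia.
have g_inj : injective g.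
  move=> c d cd; apply/ffunP => i; apply/val_inj.
  have iM : (i + k < M)%N by have := ltn_ord i; lia.
  have := route_tiling_start (ltn0Sn _) cd iM; rewrite !route_start /b leq_addl.
  rewrite addnK valK /=; have := ltn_ord (c i); have := ltn_ord (d i); lia.
have -> : (k.+1 ^ (M - k))%N = size [seq g c | c <- enum {ffun 'I_(M - k) -> 'I_k.+1}].
  by rewrite size_map -cardE card_ffun !card_ord.
apply: uniq_leq_size; first by rewrite map_inj_uniq ?enum_uniq.
by move=> T /mapP[c _ ->]; apply/in_tilings/tiling_route_tiling.
Qed.

(** * The limit of the entropy *)

Unset Implicit Arguments.

Theorem theorem2p6 (R : realType) (n : nat) (n_ge1 : (1 <= n)%N)
    (n_odd : odd n) :
  (fun M : nat => log2 (#|` tilings n (stair n M)|%:R : R) / M%:R) @ \oo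
    --> log2 (n.+1%:R : R) - 1.
Proof.
pose k := n./2; have nk : n = k.*2.+1 by rewrite -[LHS]odd_double_half n_odd.
rewrite nk; have ln2 : 0 < ln 2 :> R by rewrite ln_gt0 // ltr1n.
set a := log2 (k.+1%:R : R).
(* Here [n + 1 = 2(k+1)], and the factor 2 cancels the 1. *)
have -> : log2 (k.*2.+2%:R : R) - 1 = a.
  have -> : k.*2.+2 = (2 * k.+1)%N by lia.
  rewrite /a /log2 natrM lnM ?posrE ?ltr0n // mulrDl divff ?gt_eqF //.
  by rewrite addrC addKr.
have lnX_div j : log2 ((k.+1 ^ j)%:R : R) = j%:R * a.
  by rewrite /a /log2 natrX lnXn ?ltr0n // -[ln _ *+ j]mulr_natl mulrA.
have log2_le (i j : nat) : (0 < i)%N -> (i <= j)%N ->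
    log2 (i%:R : R) <= log2 (j%:R : R).
  move=> i0 ij; rewrite /log2 ler_pM2r ?invr_gt0 // ler_ln ?posrE ?ltr0n ?ler_nat //.
  exact: leq_trans ij.
(* The logarithms of [(k+1)^(M-k)] and [(k+1)^M], divided by [M], are these two bounds. *)
apply: (@squeeze_cvgr _ _ _ _ (fun M => a - k%:R * a * M%:R^-1) (fun=> a)).
- near=> M.
  have M0 : (0 < M)%N by near: M; exists 1%N.
  have kM : (k <= M)%N by near: M; exists k.
  have MR : 0 < M%:R :> R by rewrite ltr0n.
  have N0 : (0 < k.+1 ^ (M - k))%N by rewrite expn_gt0.
  rewrite ler_pdivlMr // ler_pdivrMr //; apply/andP; split.
    have := log2_le _ _ N0 (card_tilings_ge k M); rewrite lnX_div natrB //.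
    by apply: le_trans; rewrite mulrBl divfK ?gt_eqF // [in leRHS]mulrBl [a * _]mulrC.
  rewrite [a * _]mulrC -lnX_div log2_le ?card_tilings_le //.
  exact: leq_trans N0 (card_tilings_ge k M).
- rewrite -[X in _ --> X]subr0 -(mulr0 (k%:R * a)).
  apply: cvgB; first exact: cvg_cst.
  apply: cvgMl_tmp.
  (* Shifted by one, [1/M] is the harmonic sequence [1/(M+1)]. *)
  rewrite -(cvg_shiftS (fun M => M%:R^-1 : R)).
  exact: cvg_harmonic.
- exact: cvg_cst.
Unshelve. all: by end_near.
Qed.
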